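(* Let $m$ be a positive integer with $m\equiv 2\pmod 4$ and let $\mathbb F$ be a field with $\mathrm{char}(\mathbb F)=0$ or $2m<\mathrm{char}(\mathbb F)$. Let $V_m$ be the $\mathrm{SL}(2,\mathbb F)$-module of homogeneous polynomials of degree $m$ in $\mathbb F[X,Y]$. Then $V_m$ is an absolutely irreducible ESQ-module for $\mathrm{SL}(2,\mathbb F)$. Further, if $|\mathbb F|\geq 5$, the corresponding IAC algebra $L$ (with underlying space $V_m$) is simple.
   Context: The group $\mathrm{SL}(2,\mathbb F)$ acts on $\mathbb F[X,Y]$ by linear substitution: for $A=(a_{ij})$, $\left(\sum\lambda_{ij}X^iY^j\right)A=\sum\lambda_{ij}(a_{11}X+a_{12}Y)^i(a_{21}X+a_{22}Y)^j$; $V_m$ has dimension $m+1$. For a group $H$, an $\mathbb FH$-module $V$ is an ESQ-module if there is an $\mathbb FH$-submodule $U$ of $\wedge^2V$ with $\wedge^2V/U\cong V$. If $V$ is an irreducible ESQ-module and $\psi\colon\wedge^2V\to V$ is an $\mathbb FH$-module epimorphism, the corresponding algebra is $V$ with product $\llbracket u,v\rrbracket=(u\wedge v)\psi$. It is an IAC algebra, i.e. $\llbracket x,x\rrbracket=0$ for all $x$ and its automorphism group acts irreducibly on it. An algebra is simple if it is non-zero and its only ideals are $0$ and itself. *)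

(* Defs.v *)
From HB Require Import structures.
From mathcomp Require Import all_boot all_order all_algebra all_fingroup.
From mathcomp Require Import mpoly.

Set Implicit Arguments.
Unset Strict Implicit.
Unset Printing Implicit Defensive.

Import GRing.Theory.
Local Open Scope ring_scope.

(* Modules of a group H are finite dimensional vector spaces on which H acts
   linearly on the right: v . (g h) = (v . g) . h, where v . g is [rho g v]. *)
Record modact (H : groupType) (F : fieldType) (V : vectType F) := ModAct {
  act :> H -> 'End(V);
  act1 : act 1%g = \1%VF;
  actM : forall g h : H, act (g * h)%g = (act h \o act g)%VF }.

Section Modules.
Variables (H : groupType) (F : fieldType).

Definition submod (V : vectType F) (rho : modact H V) (U : {vspace V}) :=
  forall g, (rho g @: U <= U)%VS.

Definition modhom (V W : vectType F) (rho : modact H V) (sigma : modact H W)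
    (h : 'Hom(V, W)) :=
  forall g v, h (rho g v) = sigma g (h v).

Definition mod_isom (V W : vectType F) (rho : modact H V)
    (sigma : modact H W) :=
  exists2 h : 'Hom(V, W), modhom rho sigma h & bijective h.

Definition irreducible (V : vectType F) (rho : modact H V) :=
  (fullv : {vspace V}) <> 0%VS /\
  forall U : {vspace V}, submod rho U -> U = 0%VS \/ U = fullv.

End Modules.

(* Extension of scalars along f : F -> E.  The E-space V (x)_F E has the basis
   (e_i (x) 1)_i with e = vbasis {:V}; in these coordinates it is 'rV[E]_n, and
   g acts by the image under f of its matrix in the basis e. *)
Section BaseChange.
Variables (H : groupType) (F : fieldType) (V : vectType F) (rho : modact H V).
Variables (E : fieldType) (f : {rmorphism F -> E}).

Let e := vbasis (fullv : {vspace V}).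

Definition base_change_fun (g : H) : 'End('rV[E]_(\dim {:V})) :=
  linfun (mulmxr (map_mx f (passmx.mxof e e (rho g)))).

Lemma base_change1 : base_change_fun 1%g = \1%VF.
Proof.
apply/lfunP => v; rewrite !lfunE /= act1 passmx.mxof1 ?(basis_free (vbasisP _)) //.
by rewrite map_mx1 mulmx1.
Qed.

Lemma base_changeM g h :
  base_change_fun (g * h)%g = (base_change_fun h \o base_change_fun g)%VF.
Proof.
apply/lfunP => v; rewrite comp_lfunE !lfunE /= actM.
by rewrite (passmx.mxof_comp _ _ (vbasisP _)) map_mxM mulmxA.
Qed.

Definition base_change : modact H 'rV[E]_(\dim {:V}) :=
  ModAct base_change1 base_changeM.

End BaseChange.

Definition absolutely_irreducible (H : groupType) (F : fieldType)
    (V : vectType F) (rho : modact H V) :=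
  forall (E : fieldType) (f : {rmorphism F -> E}),
    irreducible (base_change rho f).

(* The quotient V / U, carried by a complement of U; quotv_pi is the canonical
   projection V -> V / U. *)
Section Quotient.
Variables (F : fieldType) (V : vectType F) (U : {vspace V}).

Definition quotv := subvs_of (U^C)%VS.
HB.instance Definition _ := Vector.on quotv.

Definition quotv_pi : 'Hom(V, quotv) :=
  (linfun (@vsproj F V (U^C)%VS) \o daddv_pi (U^C)%VS U)%VF.

Lemma quotv_piK : cancel (vsval : quotv -> V) quotv_pi.
Proof.
move=> w; rewrite comp_lfunE lfunE /= daddv_pi_id ?subvsP ?vsvalK //.
by rewrite capvC capv_compl.
Qed.

Lemma quotv_pi_sub v : v - vsval (quotv_pi v) \in U.
Proof.
rewrite comp_lfunE lfunE /= vsprojK ?memv_pi //.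
have capC : (U^C :&: U = 0)%VS by rewrite capvC capv_compl.
have vUU : v \in (U^C + U)%VS by rewrite addvC addv_complf memvf.
by rewrite -[X in X - _](daddv_pi_add capC vUU) addrC addKr memv_pi.
Qed.

Lemma lker_quotv_pi : lker quotv_pi = U.
Proof.
apply/vspaceP => v; rewrite memv_ker; apply/eqP/idP => [v0 | vU].
  by have := quotv_pi_sub v; rewrite v0 [vsval 0]linear0 subr0.
apply/val_inj/eqP; rewrite -memv0 -(capv_compl U) memv_cap subvsP andbT.
have := rpredB vU (quotv_pi_sub v); by rewrite subKr.
Qed.

Lemma limg_quotv_pi : limg quotv_pi = fullv.
Proof.
apply/vspaceP => w; rewrite memvf; apply/memv_imgP.
by exists (vsval w); rewrite ?memvf ?quotv_piK.
Qed.

Lemma quotv_pi_eq v : quotv_pi v = 0 <-> v \in U.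
Proof.
have <- : (v \in lker quotv_pi) = (v \in U) by rewrite lker_quotv_pi.
by rewrite memv_ker; split => /eqP.
Qed.

Definition quotv_lift (W : vectType F) (h : 'Hom(V, W)) : 'Hom(quotv, W) :=
  (h \o linfun (vsval : quotv -> V))%VF.

Lemma quotv_liftE (W : vectType F) (h : 'Hom(V, W)) v :
  (U <= lker h)%VS -> quotv_lift h (quotv_pi v) = h v.
Proof.
move=> Uh; rewrite comp_lfunE lfunE /=; apply/esym/eqP.
by rewrite -subr_eq0 -linearB -memv_ker (subvP Uh) ?quotv_pi_sub.
Qed.

Lemma quotv_ext (W : vectType F) (h k : 'Hom(quotv, W)) :
  (forall v, h (quotv_pi v) = k (quotv_pi v)) -> h = k.
Proof. by move=> hk; apply/lfunP => w; rewrite -(quotv_piK w) hk. Qed.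

End Quotient.

Section QuotientModule.
Variables (H : groupType) (F : fieldType) (V : vectType F) (rho : modact H V).
Variables (U : {vspace V}) (subU : submod rho U).

Definition quot_fun (g : H) : 'End(quotv U) :=
  quotv_lift U (quotv_pi U \o rho g)%VF.

Lemma quot_funE g v : quot_fun g (quotv_pi U v) = quotv_pi U (rho g v).
Proof.
rewrite quotv_liftE ?comp_lfunE //; apply/subvP => u uU.
by rewrite memv_ker comp_lfunE; apply/eqP/quotv_pi_eq/(subvP (subU g))/memv_img.
Qed.

Lemma quot_fun1 : quot_fun 1%g = \1%VF.
Proof. by apply: quotv_ext => v; rewrite quot_funE act1 !lfunE. Qed.

Lemma quot_funM g h : quot_fun (g * h)%g = (quot_fun h \o quot_fun g)%VF.
Proof.
by apply: quotv_ext => v; rewrite [RHS]comp_lfunE !quot_funE actM comp_lfunE.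
Qed.

Definition quot_mod : modact H (quotv U) := ModAct quot_fun1 quot_funM.

End QuotientModule.

(* The tensor square V (x) V, realised as Hom(V^*, V) by letting u (x) v be the
   map phi |-> phi(u) v. *)
Section TensorSquare.
Variables (F : fieldType) (V : vectType F).

Definition tens2 := 'Hom('Hom(V, F^o), V).
HB.instance Definition _ := Vector.on tens2.

Definition tens_fun (u v : V) (phi : 'Hom(V, F^o)) : V := (phi u : F) *: v.

Lemma tens_fun_linear u v : linear (tens_fun u v).
Proof.
by move=> a p q; rewrite /tens_fun add_lfunE scale_lfunE scalerDl -scalerA.
Qed.
HB.instance Definition _ u v :=
  GRing.isLinear.Build F _ _ _ (tens_fun u v) (tens_fun_linear u v).

Definition tens (u v : V) : tens2 := linfun (tens_fun u v).

Lemma tensE u v phi : (tens u v : 'Hom(_, _)) phi = (phi u : F) *: v.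
Proof. by rewrite lfunE. Qed.

Lemma tens_linear_l v : linear (tens^~ v).
Proof.
move=> a x y; apply/lfunP => p.
by rewrite add_lfunE scale_lfunE !tensE linearP scalerDl -scalerA.
Qed.

Lemma tens_linear_r u : linear (tens u).
Proof.
move=> a x y; apply/lfunP => p.
by rewrite add_lfunE scale_lfunE !tensE scalerDr !scalerA mulrC.
Qed.

Let e := vbasis (fullv : {vspace V}).
Let ecoord i : 'Hom(V, F^o) := linfun (coord e i : V -> F^o).

Lemma tens_decomp (T : tens2) :
  T = \sum_(i < \dim {:V}) tens e`_i ((T : 'Hom(_, _)) (ecoord i)).
Proof.
apply/lfunP => p; rewrite sum_lfunE.
rewrite {1}(_ : p = \sum_(i < \dim {:V}) (p e`_i : F) *: ecoord i).
  rewrite linear_sum; apply: eq_bigr => i _.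
  by rewrite linearZ tensE.
apply/lfunP => v; rewrite {1}(coord_vbasis (memvf v)) linear_sum sum_lfunE.
apply: eq_bigr => i _; rewrite linearZ !lfunE /= lfunE /=.
exact: mulrC.
Qed.

Lemma tens_universal (W : vectType F) (b : V -> V -> W) :
  (forall u, linear (b u)) -> (forall v, linear (b^~ v)) ->
  exists h : 'Hom(tens2, W), forall u v, h (tens u v) = b u v.
Proof.
move=> br bl.
pose lb u : {linear V -> W} := HB.pack (b u) (GRing.isLinear.Build F _ _ _ _ (br u)).
pose rb v : {linear V -> W} := HB.pack (b^~ v) (GRing.isLinear.Build F _ _ _ _ (bl v)).
pose hf (T : tens2) := \sum_(i < \dim {:V}) lb e`_i ((T : 'Hom(_, _)) (ecoord i)).
have hlin : linear hf.
  move=> a S T; rewrite /hf scaler_sumr -big_split; apply: eq_bigr => i _.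
  by rewrite add_lfunE scale_lfunE linearP.
pose h : {linear tens2 -> W} := HB.pack hf (GRing.isLinear.Build F _ _ _ _ hlin).
exists (linfun h) => u v; rewrite lfunE /= /hf.
rewrite -[RHS]/(rb v u) {2}(coord_vbasis (memvf u)) linear_sum.
by apply: eq_bigr => i _; rewrite linearZ tensE linearZ lfunE.
Qed.

Lemma tens_ext (W : vectType F) (h k : 'Hom(tens2, W)) :
  (forall u v, h (tens u v) = k (tens u v)) -> h = k.
Proof.
move=> hk; apply/lfunP => T; rewrite (tens_decomp T) !linear_sum.
by apply: eq_bigr => i _; apply: hk.
Qed.

(* The span of all squares v (x) v: finitely many of them suffice, see
   tens_sqP. *)
Definition tens_sq : {vspace tens2} :=
  let B : seq V := 0 :: vbasis fullv in
  span [seq tens (x + y) (x + y) | x <- B, y <- B].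

Lemma tens_sqP (K : {vspace tens2}) :
  (tens_sq <= K)%VS <-> forall v, tens v v \in K.
Proof.
split=> [sK v | sK]; last first.
  by apply/span_subvP => _ /allpairsP[[x y] [_ _ ->]]; exact: sK.
pose tl w : {linear V -> tens2} :=
  HB.pack (tens^~ w) (GRing.isLinear.Build F _ _ _ _ (tens_linear_l w)).
pose tr w : {linear V -> tens2} :=
  HB.pack (tens w) (GRing.isLinear.Build F _ _ _ _ (tens_linear_r w)).
have tDl x y z : tens (x + y) z = tens x z + tens y z := linearD (tl z) x y.
have tDr x y z : tens z (x + y) = tens z x + tens z y := linearD (tr z) x y.
have tZl a x y : tens (a *: x) y = a *: tens x y := linearZ_LR (tl y) a x.
have tZr a x y : tens x (a *: y) = a *: tens x y := linearZ_LR (tr x) a y.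
have sq x y : x \in 0 :: vbasis fullv -> y \in 0 :: vbasis fullv ->
    tens (x + y) (x + y) \in K.
  move=> xB yB; apply/(subvP sK)/memv_span/allpairsP.
  by exists (x, y).
have eB i : e`_i \in 0 :: vbasis fullv.
  rewrite inE; case: (ltnP i (size e)) => [lti | gei].
    by rewrite mem_nth ?orbT.
  by rewrite nth_default ?eqxx.
have sqe i : tens e`_i e`_i \in K.
  by have := sq _ _ (eB i) (mem_head _ _); rewrite addr0.
have sym i j : tens e`_i e`_j + tens e`_j e`_i \in K.
  have := sq _ _ (eB i) (eB j); rewrite tDl !tDr => s.
  have := rpredB (rpredB s (sqe i)) (sqe j).
  by rewrite [X in X - _ - _]addrA [X in X - _]addrAC addrK -(addrA (tens _ _)) addrC addKr.
have vE := coord_vbasis (memvf v).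
have key (n : nat) (d : nat -> F) :
    let w := \sum_(i < n) d i *: e`_i in tens w w \in K.
  elim: n => [|n IHn] /=.
    by rewrite big_ord0 -[tens 0 0]/(tl 0 0) linear0 mem0v.
  rewrite big_ord_recr /=; set w := \sum_(i < n) _ in IHn *; set z := _ *: _.
  have -> : tens (w + z) (w + z) = tens w w + (tens w z + tens z w) + tens z z.
    by rewrite tDl !tDr !addrA.
  have tzz : tens z z \in K.
    by rewrite /z tZl tZr !memvZ.
  apply: rpredD => //; apply: rpredD; first exact: IHn.
  rewrite -[tens w z]/(tl z w) -[tens z w]/(tr z w) /w !linear_sum -big_split.
  apply: rpred_sum => i _ /=.
  rewrite -[X in X + _]/(tens (d i *: e`_i) z) -[X in _ + X]/(tens z (d i *: e`_i)).
  by rewrite /z !tZl !tZr !scalerA mulrC -scalerDr memvZ.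
have := key (\dim {:V}) (fun i => if insub i is Some j then coord e j v else 0).
rewrite /= (eq_bigr (fun i : 'I_(\dim {:V}) => coord e i v *: e`_i)) -?vE //.
by move=> i _; rewrite valK.
Qed.

(* f (x) f as an endomorphism of V (x) V: the map T |-> f T f^*. *)
Section TensMap.
Variable f : 'End(V).

Definition dual_fun (phi : 'Hom(V, F^o)) : 'Hom(V, F^o) := (phi \o f)%VF.

Lemma dual_fun_linear : linear dual_fun.
Proof. by move=> a p q; rewrite /dual_fun comp_lfunDl comp_lfunZl. Qed.
HB.instance Definition _ :=
  GRing.isLinear.Build F _ _ _ dual_fun dual_fun_linear.

Definition tens_map_fun (T : tens2) : tens2 :=
  (f \o ((T : 'Hom(_, _)) \o linfun dual_fun))%VF.

Lemma tens_map_fun_linear : linear tens_map_fun.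
Proof.
move=> a S T; rewrite /tens_map_fun.
by rewrite comp_lfunDl comp_lfunDr comp_lfunZr comp_lfunZl.
Qed.
HB.instance Definition _ :=
  GRing.isLinear.Build F _ _ _ tens_map_fun tens_map_fun_linear.

Definition tens_map : 'End(tens2) := linfun tens_map_fun.

Lemma tens_mapE u v : tens_map (tens u v) = tens (f u) (f v).
Proof.
rewrite lfunE /= /tens_map_fun; apply/lfunP => p.
by rewrite comp_lfunE comp_lfunE !tensE linearZ [linfun _ p]lfunE /= comp_lfunE.
Qed.

End TensMap.

End TensorSquare.

(* The exterior square: V (x) V modulo the span of all squares v (x) v. *)
Section ExteriorSquare.
Variables (F : fieldType) (V : vectType F).

Definition ext2 := quotv (tens_sq V).
HB.instance Definition _ := Vector.on ext2.

Definition wedge (u v : V) : ext2 := quotv_pi (tens_sq V) (tens u v).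

Lemma wedge_linear_l v : linear (wedge^~ v).
Proof. by move=> a x y; rewrite /wedge tens_linear_l linearP. Qed.

Lemma wedge_linear_r u : linear (wedge u).
Proof. by move=> a x y; rewrite /wedge tens_linear_r linearP. Qed.

Lemma wedge_alt v : wedge v v = 0.
Proof. by apply/quotv_pi_eq; apply: (tens_sqP _).1. Qed.

Lemma ext2_universal (W : vectType F) (b : V -> V -> W) :
    (forall u, linear (b u)) -> (forall v, linear (b^~ v)) ->
    (forall v, b v v = 0) ->
  exists! h : 'Hom(ext2, W), forall u v, h (wedge u v) = b u v.
Proof.
move=> br bl b0; have [h hE] := tens_universal br bl.
have hK : (tens_sq V <= lker h)%VS.
  by apply/tens_sqP => v; rewrite memv_ker hE b0.
exists (quotv_lift (tens_sq V) h); split=> [u v | k kE].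
  by rewrite /wedge quotv_liftE.
apply: quotv_ext => T; rewrite quotv_liftE // -comp_lfunE.
by congr (fun_of_lfun _ T); apply: tens_ext => u v; rewrite comp_lfunE kE hE.
Qed.

End ExteriorSquare.

Section ExteriorModule.
Variables (H : groupType) (F : fieldType) (V : vectType F) (rho : modact H V).

Lemma tens_mod1 : tens_map (rho 1%g) = \1%VF.
Proof. by apply: tens_ext => u v; rewrite tens_mapE act1 !lfunE. Qed.

Lemma tens_modM g h :
  tens_map (rho (g * h)%g) = (tens_map (rho h) \o tens_map (rho g))%VF.
Proof.
by apply: tens_ext => u v; rewrite [RHS]comp_lfunE !tens_mapE actM !comp_lfunE.
Qed.

Definition tens_mod : modact H (tens2 V) := ModAct tens_mod1 tens_modM.

Lemma tens_sq_submod : submod tens_mod (tens_sq V).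
Proof.
move=> g; suff sq : (tens_sq V <= tens_map (rho g) @^-1: tens_sq V)%VS.
  by apply/subvP => _ /memv_imgP[T TS ->]; rewrite memv_preim (subvP sq).
apply/tens_sqP => v; rewrite -memv_preim tens_mapE.
exact: (tens_sqP _).1.
Qed.

Definition ext2_mod : modact H (ext2 V) := quot_mod tens_sq_submod.

Lemma ext2_modE g u v : ext2_mod g (wedge u v) = wedge (rho g u) (rho g v).
Proof.
by rewrite /wedge [LHS](quot_funE tens_sq_submod) -(tens_mapE (rho g)).
Qed.

Definition ESQ_module :=
  exists (U : {vspace ext2 V}) (subU : submod ext2_mod U),
    mod_isom (quot_mod subU) rho.

End ExteriorModule.

(* The product on V defined by a linear map psi from the exterior square. *)
Definition esq_prod (F : fieldType) (V : vectType F) (psi : 'Hom(ext2 V, V))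
  (u v : V) : V := psi (wedge u v).

Section Algebras.
Variables (F : fieldType) (L : vectType F) (mul : L -> L -> L).

Definition alg_aut (f : 'End(L)) :=
  bijective f /\ forall x y, f (mul x y) = mul (f x) (f y).

Definition alg_ideal (I : {vspace L}) :=
  forall x y, x \in I -> mul x y \in I /\ mul y x \in I.

Definition simple_alg :=
  (fullv : {vspace L}) <> 0%VS /\
  forall I, alg_ideal I -> I = 0%VS \/ I = fullv.

Definition IAC_alg :=
  (forall x, mul x x = 0) /\
  (fullv : {vspace L}) <> 0%VS /\
  forall U : {vspace L}, (forall f, alg_aut f -> (f @: U <= U)%VS) ->
    U = 0%VS \/ U = fullv.

End Algebras.

Section SpecialLinear.
Variables (n : nat) (F : fieldType).

Record SL := MkSL { SL_mx :> 'M[F]_n; SL_det : \det SL_mx == 1 }.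
HB.instance Definition _ := [isSub for SL_mx].
HB.instance Definition _ := [Choice of SL by <:].

Implicit Types A B C : SL.

Lemma SL_unit A : (A : 'M_n) \in unitmx.
Proof. by rewrite unitmxE (eqP (SL_det A)) unitr1. Qed.

Lemma SL1_subproof : \det (1%:M : 'M[F]_n) == 1.
Proof. by rewrite det1. Qed.
Lemma SLM_subproof A B : \det (A *m B) == 1.
Proof. by rewrite det_mulmx !(eqP (SL_det _)) mulr1. Qed.
Lemma SLV_subproof A : \det (invmx A) == 1.
Proof. by rewrite det_inv (eqP (SL_det A)) invr1. Qed.

Definition SL_one := MkSL SL1_subproof.
Definition SL_mul A B := MkSL (SLM_subproof A B).
Definition SL_inv A := MkSL (SLV_subproof A).

Lemma SL_mulA : associative SL_mul.
Proof. by move=> A B C; apply/val_inj/mulmxA. Qed.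
Lemma SL_mul1 : left_id SL_one SL_mul.
Proof. by move=> A; apply/val_inj/mul1mx. Qed.
Lemma SL_mulr1 : right_id SL_one SL_mul.
Proof. by move=> A; apply/val_inj/mulmx1. Qed.
Lemma SL_mulV : left_inverse SL_one SL_inv SL_mul.
Proof. by move=> A; apply/val_inj/mulVmx/SL_unit. Qed.
Lemma SL_mulrV : right_inverse SL_one SL_inv SL_mul.
Proof. by move=> A; apply/val_inj/mulmxV/SL_unit. Qed.

HB.instance Definition _ :=
  isGroup.Build SL SL_mulA SL_mul1 SL_mulr1 SL_mulV SL_mulrV.

End SpecialLinear.

(* V_m is [dhomog 2 F m], the homogeneous polynomials of degree m in the two
   variables 'X_0 = X and 'X_1 = Y. *)
Section BinaryForms.
Variables (F : fieldType) (m : nat).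

Definition lin_forms (A : 'M[F]_2) : 2.-tuple {mpoly F[2]} :=
  [tuple \sum_j A i j *: 'X_j | i < 2].

Lemma lin_subst_homog (A : 'M[F]_2) (p : dhomog 2 F m) :
  (p : {mpoly F[2]}) \mPo lin_forms A \is m.-homog.
Proof.
rewrite comp_mpolyEX big_seq; apply: rpred_sum => k kp; apply: rpredZ.
have <- : mdeg k = m := dhomogP _ _ _ (valP p) k kp.
rewrite comp_mpolyX mdegE.
apply: (big_ind2 (fun (q : {mpoly F[2]}) d => q \is d.-homog)) => [||i _].
- exact: dhomog1.
- by move=> *; apply: dhomogM.
rewrite -[X in X.-homog]mul1n; apply: dhomogMn.
rewrite tnth_mktuple; apply: rpred_sum => j _; apply: rpredZ.
by rewrite dhomogX /= mdeg1.
Qed.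

Definition lin_subst (A : 'M[F]_2) (p : dhomog 2 F m) : dhomog 2 F m :=
  DHomog (lin_subst_homog A p).

Lemma lin_subst_linear A : linear (lin_subst A).
Proof. by move=> a p q; apply/val_inj; rewrite /= linearP. Qed.
HB.instance Definition _ A :=
  GRing.isLinear.Build F _ _ _ (lin_subst A) (lin_subst_linear A).

Lemma lin_forms1 : lin_forms 1%:M = [tuple 'X_i | i < 2].
Proof.
apply: eq_mktuple => i; rewrite (bigD1 i) //= mxE eqxx scale1r big1 ?addr0 //.
by move=> j ji; rewrite mxE eq_sym (negPf ji) scale0r.
Qed.

Lemma lin_formsM A B (p : {mpoly F[2]}) :
  p \mPo lin_forms (A *m B) = (p \mPo lin_forms A) \mPo lin_forms B.
Proof.
rewrite !(comp_mpolyEX p) raddf_sum; apply: eq_bigr => k _ /=.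
rewrite !comp_mpolyZ !comp_mpolyX rmorph_prod; congr (_ *: _).
apply: eq_bigr => i _; rewrite rmorphXn /= !tnth_mktuple; congr (_ ^+ _).
rewrite raddf_sum /=; under [RHS]eq_bigr => l _.
  rewrite comp_mpolyZ comp_mpolyXU -tnth_nth tnth_mktuple scaler_sumr.
  over.
rewrite exchange_big; apply: eq_bigr => j _; rewrite mxE scaler_suml.
by apply: eq_bigr => l _; rewrite scalerA.
Qed.

Definition binform_act (A : SL 2 F) : 'End(dhomog 2 F m) :=
  linfun (lin_subst A).

Lemma binform_act1 : binform_act 1%g = \1%VF.
Proof.
by apply/lfunP => p; rewrite !lfunE; apply/val_inj; rewrite /= lin_forms1 comp_mpoly_id.
Qed.

Lemma binform_actM A B :
  binform_act (A * B)%g = (binform_act B \o binform_act A)%VF.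
Proof.
apply/lfunP => p; rewrite comp_lfunE !lfunE; apply/val_inj.
exact: lin_formsM.
Qed.

Definition binform_mod : modact (SL 2 F) (dhomog 2 F m) :=
  ModAct binform_act1 binform_actM.

End BinaryForms.

(* Main.v *)
Require Import Defs.
From HB Require Import structures.
From mathcomp Require Import all_boot all_order all_algebra all_fingroup.
From mathcomp Require Import mpoly.
From mathcomp Require Import zify ring.
From Stdlib Require Import Classical.
Import GRing.Theory.
Local Open Scope ring_scope.

Set Implicit Arguments.
Unset Strict Implicit.
Unset Printing Implicit Defensive.

(* The shear X -> X + sY acts on V_m by a polynomial in s; since F has more than
   2m elements, its coefficients can be extracted, and the coefficient of s is
   D = Y d/dX, which lowers the monomials X^i Y^(m-i) with nonzero factors.  A
   nonzero D-stable subspace contains Y^m, and one that contains X^m is V_m; as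
   the Weyl element exchanges Y^m and X^m up to sign, V_m is absolutely
   irreducible.  The transvectant of odd order m/2 is a nonzero equivariant
   alternating product on V_m, so it is onto.

   For any equivariant product the coefficient of s in the equivariance under
   shears says that D is a derivation.  A minimal ideal I satisfies [I, I] = I,
   because it meets each of its translates, which span V_m, in 0 or I.  Hence I
   and its translates are stable under all derivations, so they all contain Y^m,
   and I contains X^m. *)

(** * Ladder operators *)

(** Interpolation: the Vandermonde matrix of distinct nodes is invertible, so each [w k] is a linear
    combination of the values at the nodes. *)
Lemma mem_coef_of_values (K : fieldType) (W : vectType K) (U : {vspace W})
    (d : nat) (x : 'I_d -> K) (w : 'I_d -> W) :
  injective x -> (forall j, \sum_(k < d) x j ^+ k *: w k \in U) ->
  forall k, w k \in U.
Proof.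
move=> xI wU l.
pose V := Vandermonde d (\row_j x j).
have Vu : V \in unitmx.
  rewrite unitmxE det_Vandermonde unitfE; apply/prodf_neq0 => i _.
  apply/prodf_neq0 => j ij; rewrite !mxE subr_eq0.
  by apply/eqP => /xI e; rewrite e ltnn in ij.
have -> : w l = \sum_j invmx V j l *: \sum_(k < d) x j ^+ k *: w k.
  under eq_bigr do rewrite scaler_sumr.
  rewrite exchange_big /= (bigD1 l) //= [X in _ + X]big1 ?addr0 => [|k kl].
    under eq_bigr do rewrite scalerA.
    rewrite -scaler_suml; have /matrixP/(_ l l) := mulmxV Vu.
    rewrite !mxE eqxx => Vl; rewrite -[LHS]scale1r -[1]Vl.
    by congr (_ *: _); apply: eq_bigr => j _; rewrite !mxE mulrC.
  under eq_bigr do rewrite scalerA.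
  rewrite -scaler_suml; have /matrixP/(_ k l) := mulmxV Vu.
  rewrite !mxE (negPf kl) => Vl; rewrite -[RHS](scale0r (w k)) -[0 in RHS]Vl.
  by congr (_ *: _); apply: eq_bigr => j _; rewrite !mxE mulrC.
by apply: rpred_sum => j _; apply: rpredZ; apply: wU.
Qed.

(** Induction on the length: a zero top coefficient is dropped; otherwise [D] moves the combination
    one rung down, and the new top coefficient [a m * m%:R] is again nonzero. *)
Lemma ladder_bottom (K : fieldType) (W : vectType K) (m : nat) (e : nat -> W)
    (D : 'End(W)) (U : {vspace W}) (a : nat -> K) :
    D (e 0%N) = 0 ->
    (forall i, (i < m)%N -> D (e i.+1) = i.+1%:R *: e i) ->
    (forall i, (i < m)%N -> i.+1%:R != 0 :> K) ->
    (forall v, v \in U -> D v \in U) ->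
  (exists2 i, (i <= m)%N & a i != 0) ->
  \sum_(i < m.+1) a i *: e i \in U -> e 0%N \in U.
Proof.
move=> D0 De c0 DU.
elim: m De c0 a => [|m IHm] De c0 a [i im ai].
  rewrite big_ord1; case: i im ai => // _ a0 /(memvZ (a 0%N)^-1).
  by rewrite scalerA mulVf ?scale1r.
have IH := IHm (fun i im => De i (ltnW im)) (fun i im => c0 i (ltnW im)).
rewrite big_ord_recr /=; have [am|am] := eqVneq (a m.+1) 0.
  rewrite am scale0r addr0; apply: IH; exists i => //.
  by rewrite leq_eqVlt ltnS in im; case/orP: im => // /eqP im; rewrite im am eqxx in ai.
move=> /DU; rewrite linearD linear_sum big_ord_recl /= linearZ /= D0 scaler0 add0r.
rewrite linearZ /= De // scalerA => vU.
apply: (IH (fun i => a i.+1 * i.+1%:R)); first by exists m; rewrite ?mulf_neq0 ?c0.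
rewrite big_ord_recr /=; apply: etrans vU; congr (_ + _ \in U).
apply: eq_bigr => j _; rewrite linearZ /= /bump /= add1n De ?scalerA //.
exact: ltnW (ltn_ord j).
Qed.

Lemma ladder_bottom_mem (K : fieldType) (W : vectType K) (m : nat)
    (e : nat -> W) (D : 'End(W)) (U : {vspace W}) :
    D (e 0%N) = 0 ->
    (forall i, (i < m)%N -> D (e i.+1) = i.+1%:R *: e i) ->
    (forall i, (i < m)%N -> i.+1%:R != 0 :> K) ->
    (forall v, exists a : nat -> K, v = \sum_(i < m.+1) a i *: e i) ->
    (forall v, v \in U -> D v \in U) ->
  U != 0%VS -> e 0%N \in U.
Proof.
move=> D0 De c0 sp DU U0; have vU := memv_pick U.
have [a va] := sp (vpick U); rewrite va in vU.
apply: (ladder_bottom D0 De c0 DU _ vU).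
have [[i ai]|na] := pickP (fun i : 'I_m.+1 => a i != 0).
  by exists i; rewrite // -ltnS.
move: U0; rewrite -vpick0 va big1 ?eqxx // => i _.
by move/negbFE/eqP: (na i) => ->; rewrite scale0r.
Qed.

Lemma ladder_full (K : fieldType) (W : vectType K) (m : nat) (e : nat -> W)
    (D : 'End(W)) (U : {vspace W}) :
    (forall i, (i < m)%N -> D (e i.+1) = i.+1%:R *: e i) ->
    (forall i, (i < m)%N -> i.+1%:R != 0 :> K) ->
    (forall v, v \in U -> D v \in U) ->
    (forall v, exists a : nat -> K, v = \sum_(i < m.+1) a i *: e i) ->
  e m \in U -> U = fullv.
Proof.
move=> De c0 DU sp em.
have eU k : (k <= m)%N -> e (m - k)%N \in U.
  elim: k => [|k IHk] km; first by rewrite subn0.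
  have := DU _ (IHk (ltnW km)).
  rewrite -subSS subSn // De ?ltn_subrL ?(leq_trans _ km) //.
  move/(memvZ ((m - k.+1).+1%:R)^-1).
  by rewrite scalerA mulVf ?scale1r ?c0 // ltn_subrL (leq_trans _ km).
apply/vspaceP => v; rewrite memvf; have [a ->] := sp v.
apply: rpred_sum => i _; apply: rpredZ.
by rewrite -(subKn (_ : i <= m)%N) ?eU ?leq_subr // -ltnS.
Qed.

(** Here [w] stands for the Weyl element: [D] leads from any nonzero vector of [U] down to [e 0],
    [w] carries [e 0] up to [e m], and from there [D] passes through every [e i]. *)
Lemma ladder_irreducible (K : fieldType) (W : vectType K) (m : nat)
    (e : nat -> W) (D w : 'End(W)) (c : K) (U : {vspace W}) :
    D (e 0%N) = 0 ->
    (forall i, (i < m)%N -> D (e i.+1) = i.+1%:R *: e i) ->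
    (forall i, (i < m)%N -> i.+1%:R != 0 :> K) ->
    (forall v, exists a : nat -> K, v = \sum_(i < m.+1) a i *: e i) ->
    w (e 0%N) = c *: e m -> c != 0 ->
    (forall v, v \in U -> D v \in U) -> (forall v, v \in U -> w v \in U) ->
  U = 0%VS \/ U = fullv.
Proof.
move=> D0 De c0 sp we cn0 DU wU; have [->|U0] := eqVneq U 0%VS; [by left|right].
apply: (ladder_full De c0 DU sp).
suff /wU : e 0%N \in U by rewrite we => /(memvZ c^-1); rewrite scalerA mulVf ?scale1r.
exact: ladder_bottom_mem D0 De c0 sp DU U0.
Qed.

(** * Binary forms under shears *)

Definition mono_exp (i j : nat) : 'X_{1..2} := (U_(0%R) *+ i + U_(1%R) *+ j)%MM.

Lemma mono_exp0 i j : mono_exp i j 0%R = i.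
Proof. by rewrite mnmDE !mulmnE !mnm1E /= mul1n mul0n addn0. Qed.

Lemma mono_exp1 i j : mono_exp i j 1%R = j.
Proof. by rewrite mnmDE !mulmnE !mnm1E /= mul1n mul0n. Qed.

Lemma mono_expE (k : 'X_{1..2}) : k = mono_exp (k 0%R) (k 1%R).
Proof.
apply/mnmP; case=> [[|[|//]] lti].
  by rewrite (_ : Ordinal lti = 0) ?mono_exp0 //; apply/val_inj.
by rewrite (_ : Ordinal lti = 1) ?mono_exp1 //; apply/val_inj.
Qed.

Lemma mdeg_mono_exp i j : mdeg (mono_exp i j) = (i + j)%N.
Proof. by rewrite mdegD !mdegMn !mdeg1 !mul1n. Qed.

Lemma mpolyX_mono_exp (F : fieldType) i j :
  'X_[mono_exp i j] = 'X_0 ^+ i * 'X_1 ^+ j :> {mpoly F[2]}.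
Proof. by rewrite mpolyXD -!mpolyXn. Qed.

Lemma det_mx22 (R : comPzRingType) (A : 'M[R]_2) : \det A = A 0 0 * A 1 1 - A 0 1 * A 1 0.
Proof.
rewrite (expand_det_row _ 0) !big_ord_recl big_ord0 /cofactor !det_mx11 !mxE /=.
rewrite expr0 expr1 addr0 mul1r mulN1r mulrN.
by congr (A _ _ * A _ _ - A _ _ * A _ _); apply/val_inj.
Qed.

Section BinaryForms.
Variables (F : fieldType) (m : nat).
Local Notation V := (dhomog 2 F m).

Lemma mono_homog i : 'X_[mono_exp (minn i m) (m - i)] \is [in F[2], m.-homog].
Proof. by rewrite dhomogX /= mdeg_mono_exp minnC minnE subnK // leq_subr. Qed.

(* [X^i Y^(m-i)] when [i <= m]; larger indices all give [X^m]. *)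
Definition mono (i : nat) : V := DHomog (mono_homog i).

Definition binform_coef (i : nat) (p : V) : F := (val p)@_(mono_exp i (m - i)).

Lemma binform_coef_linear i : linear (binform_coef i : V -> F^o).
Proof. by move=> a p q; rewrite /binform_coef [val _]linearP mcoeffD mcoeffZ. Qed.
HB.instance Definition _ i :=
  GRing.isLinear.Build F V F^o _ (binform_coef i) (binform_coef_linear i).

Lemma binform_coef_mono i j : (i <= m)%N -> (j <= m)%N ->
  binform_coef i (mono j) = (i == j)%:R.
Proof.
move=> im jm; rewrite /binform_coef mcoeffX (minn_idPl jm).
congr (nat_of_bool _)%:R; apply/eqP/eqP => [/mnmP/(_ 0%R)|->//].
by rewrite !mono_exp0.
Qed.

Lemma mono_decomp (p : V) : p = \sum_(i < m.+1) binform_coef i p *: mono i.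
Proof.
apply/val_inj/mpolyP => k; rewrite /= raddf_sum /= raddf_sum /=.
have [km|km] := eqVneq (mdeg k) m; last first.
  rewrite (dhomog_nemf_coeff (valP p) km) big1 // => i _.
  by rewrite mcoeffZ (dhomog_nemf_coeff (valP (mono i)) km) mulr0.
have k01 : (k 0%R + k 1%R)%N = m by rewrite -mdeg_mono_exp -mono_expE.
have ltk : (k 0%R < m.+1)%N by rewrite ltnS -k01 leq_addr.
have kE : k = mono_exp (k 0%R) (m - k 0%R) by rewrite -k01 addKn -mono_expE.
have bc (i : 'I_m.+1) :
    ('X_[mono_exp (minn i m) (m - i)] : {mpoly F[2]})@_k = (k 0%R == i :> nat)%:R.
  by rewrite {1}kE; apply: binform_coef_mono; rewrite -ltnS.
rewrite (bigD1 (Ordinal ltk)) //= big1 ?addr0 => [|i ik].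
  by rewrite mcoeffZ (bc (Ordinal ltk)) eqxx mulr1 /binform_coef -kE.
rewrite mcoeffZ bc (_ : _ == _ = false) ?mulr0 //.
by apply: contraNF ik => /eqP e; apply/eqP/val_inj.
Qed.

Lemma mono_neq0 i : (i <= m)%N -> mono i != 0.
Proof.
move=> im; apply/eqP => e; have := binform_coef_mono im im.
by rewrite e linear0 eqxx => /eqP; rewrite eq_sym oner_eq0.
Qed.

Definition shear_mx (s : F) : 'M[F]_2 :=
  \matrix_(i, j) (if i == j then 1 else (i < j)%:R * s).

Lemma shear_det s : \det (shear_mx s) == 1.
Proof. by rewrite det_mx22 !mxE /= !mul0r mulr0 subr0 mulr1. Qed.
Definition shear s : SL 2 F := MkSL (shear_det s).

(** The substitution X -> Y, Y -> -X; the sign makes the determinant 1. *)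
Definition weyl_mx : 'M[F]_2 :=
  \matrix_(i, j) (if i == j then 0 else (-1) ^+ i).
Lemma weyl_det : \det weyl_mx == 1.
Proof. by rewrite det_mx22 !mxE /= !mul0r sub0r mul1r opprK. Qed.
Definition weyl : SL 2 F := MkSL weyl_det.

Lemma binform_act_mono (A : SL 2 F) i : (i <= m)%N ->
  val (binform_mod F m A (mono i)) =
  (A 0 0 *: 'X_0 + A 0 1 *: 'X_1) ^+ i
  * (A 1 0 *: 'X_0 + A 1 1 *: 'X_1) ^+ (m - i).
Proof.
have l1 : lift ord0 ord0 = 1 :> 'I_2 by apply/val_inj.
move=> im; rewrite /= lfunE /= comp_mpolyX big_ord_recl big_ord1 (minn_idPl im).
rewrite l1 mono_exp0 mono_exp1 !tnth_mktuple !big_ord_recl !big_ord0 /=.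
by rewrite !addr0 l1.
Qed.

Lemma weyl_mono0 : binform_mod F m weyl (mono 0) = (-1) ^+ m *: mono m.
Proof.
apply/val_inj; rewrite binform_act_mono // [val (_ *: _)]linearZ /=.
rewrite [in RHS]mpolyX_mono_exp minnn subnn subn0 expr0 mul1r mulr1 !mxE /=.
by rewrite scale0r addr0 expr1 exprZn.
Qed.

(** The binomial theorem for (X + sY)^i. Beyond [i] the binomial coefficients vanish, so the bound
    [d] is free; both [m] and [2 * m] are used below. *)
Lemma shear_mono s d i : (m <= d)%N -> (i <= m)%N ->
  binform_mod F m (shear s) (mono i) =
  \sum_(k < d.+1) s ^+ k *: ('C(i, k)%:R *: mono (i - k)).
Proof.
move=> md im; apply/val_inj; rewrite binform_act_mono // [RHS]raddf_sum /=.
rewrite !mxE /= mul0r scale0r add0r mul1r !scale1r exprDn mulr_suml.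
rewrite -(subnKC (leq_trans im md : i.+1 <= d.+1)%N) big_split_ord /=.
rewrite [X in _ = _ + X]big1 ?addr0 => [|k _]; last first.
  by rewrite bin_small ?ltn_addr // scale0r scaler0.
apply: eq_bigr => -[k /= ki _]; rewrite ltnS in ki.
rewrite mpolyX_mono_exp (minn_idPl (leq_trans (leq_subr _ _) im)).
have -> : (m - (i - k) = k + (m - i))%N by rewrite subnBA // addnC addnBA.
rewrite exprZn exprD -scalerAr -scaler_nat -!scalerAl !scalerA mulrA.
by rewrite [_%:R * _]mulrC.
Qed.

(** The divided power D^k / k! of D = Y d/dX, written with binomial coefficients so that nothing is
    divided; the shear by s is exp(sD). *)
Definition shear_coef_fun (k : nat) (p : V) : V :=
  \sum_(i < m.+1) binform_coef i p *: ('C(i, k)%:R *: mono (i - k)).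

Lemma shear_coef_linear k : linear (shear_coef_fun k).
Proof.
move=> a p q; rewrite /shear_coef_fun scaler_sumr -big_split.
by apply: eq_bigr => i _; rewrite linearP scalerDl -scalerA.
Qed.
HB.instance Definition _ k :=
  GRing.isLinear.Build F V V _ (shear_coef_fun k) (shear_coef_linear k).

Definition shear_coef (k : nat) : 'End(V) := linfun (shear_coef_fun k).

Lemma shear_expansion s d : (m <= d)%N ->
  binform_mod F m (shear s) = \sum_(k < d.+1) s ^+ k *: shear_coef k.
Proof.
move=> md; apply/lfunP => p; set g : 'End(V) := binform_mod F m (shear s).
rewrite {1}(mono_decomp p) linear_sum sum_lfunE.
under [RHS]eq_bigr do rewrite scale_lfunE lfunE /= scaler_sumr.
rewrite exchange_big; apply: eq_bigr => i _ /=.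
rewrite linearZ /= {}/g (shear_mono s md (ltn_ord i : i <= m)%N) scaler_sumr.
by apply: eq_bigr => k _; rewrite !scalerA [_ * s ^+ k]mulrC.
Qed.

Lemma shear_coef0 p : shear_coef 0 p = p.
Proof.
rewrite lfunE /= [RHS]mono_decomp; apply: eq_bigr => i _.
by rewrite bin0 scale1r subn0.
Qed.

Lemma shear_coef1_mono i : (i <= m)%N ->
  shear_coef 1 (mono i) = i%:R *: mono i.-1.
Proof.
move=> im; rewrite lfunE /= /shear_coef_fun (bigD1 (Ordinal (im : i < m.+1)%N)) //=.
rewrite big1 ?addr0 => [|j ji].
  by rewrite binform_coef_mono // eqxx scale1r bin1 subn1.
rewrite (binform_coef_mono (ltn_ord j : j <= m)%N im) (_ : _ == _ = false) ?scale0r //.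
by apply: contraNF ji => /eqP e; apply/eqP/val_inj.
Qed.

End BinaryForms.

(** * Absolute irreducibility *)

Section BaseChangeFunctor.
Import passmx.
Variables (F E : fieldType) (f : {rmorphism F -> E}) (V : vectType F).
Let e := vbasis (fullv : {vspace V}).

Definition bc_vec (v : V) : 'rV[E]_(\dim {:V}) := map_mx f (rVof e v).

(** This is A (x) 1. It is needed for endomorphisms such as D that no group element induces; for
    [A = rho g] it is, by conversion, the action in [base_change]. *)
Definition bc_end (A : 'End(V)) : 'End('rV[E]_(\dim {:V})) :=
  linfun (mulmxr (map_mx f (mxof e e A))).

Lemma bc_endE A v : bc_end A (bc_vec v) = bc_vec (A v).
Proof.
by rewrite lfunE /= /bc_vec -map_mxM -(rVof_app _ (vbasisP _)).
Qed.

Lemma bc_vecZ a v : bc_vec (a *: v) = f a *: bc_vec v.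
Proof. by rewrite /bc_vec linearZ map_mxZ. Qed.

Lemma bc_vec_sum (I : finType) (v : I -> V) :
  bc_vec (\sum_i v i) = \sum_i bc_vec (v i).
Proof. by rewrite /bc_vec linear_sum map_mx_sum. Qed.

Lemma bc_vec_eq0 v : (bc_vec v == 0) = (v == 0).
Proof. by rewrite map_mx_eq0 (rVof_eq0 (vbasisP _)). Qed.

Lemma bc_end_sum (d : nat) (a : 'I_d -> F) (A : 'I_d -> 'End(V)) v :
  bc_end (\sum_k a k *: A k) v = \sum_k f (a k) *: bc_end (A k) v.
Proof.
rewrite lfunE /= linear_sum map_mx_sum mulmx_sumr.
by apply: eq_bigr => k _; rewrite linearZ map_mxZ -scalemxAr lfunE.
Qed.

Lemma bc_vec_span (m : nat) (b : nat -> V) (c : 'I_m.+1 -> V -> F) :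
    (forall v, v = \sum_i c i v *: b i) ->
  forall v, exists a : nat -> E, v = \sum_(i < m.+1) a i *: bc_vec (b i).
Proof.
move=> bs v.
exists (fun i => \sum_j v 0 j * f (c (inord i) e`_j)).
under eq_bigr do rewrite scaler_suml inord_val.
rewrite exchange_big {1}(row_sum_delta v); apply: eq_bigr => j _ /=.
(* The standard row vectors are the basis vectors of V tensored with 1, so it is enough to expand
   each of these in the family [b]. *)
have -> : delta_mx 0 j = bc_vec e`_j :> 'rV[E]_ _.
  by rewrite /bc_vec (rVofE (vbasisP _)) map_delta_mx ?vbasisP.
rewrite {1}[e`_j]bs bc_vec_sum scaler_sumr; apply: eq_bigr => i _.
by rewrite bc_vecZ scalerA.
Qed.

End BaseChangeFunctor.

Section Irreducible.
Variables (F : fieldType) (m : nat).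
Hypothesis m_gt0 : (0 < m)%N.
Hypothesis natF : forall i, (0 < i <= 2 * m)%N -> i%:R != 0 :> F.
Local Notation V := (dhomog 2 F m).
Local Notation rho := (binform_mod F m).

(** Supplies the interpolation nodes 0, ..., 2m, which stay distinct in [F]. *)
Lemma natr_inj_small (i j : nat) : (i <= 2 * m)%N -> (j <= 2 * m)%N ->
  i%:R = j%:R :> F -> i = j.
Proof.
wlog ij : i j / (i <= j)%N => [h im jm e|im jm e].
  by have [/h|/ltnW/h h'] := leqP i j; [exact | apply/esym/h'].
apply/eqP; rewrite eqn_leq ij /= leqNgt; apply/negP => ltij.
have /natF/negP[] : (0 < j - i <= 2 * m)%N.
  by rewrite subn_gt0 ltij (leq_trans (leq_subr _ _) jm).
by rewrite natrB // e subrr.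
Qed.

Lemma natF_ladder i : (i < m)%N -> i.+1%:R != 0 :> F.
Proof. by move=> im; apply: natF; rewrite /= (leq_trans im) // leq_pmull. Qed.

(** Interpolation at 0, ..., d. After extension of scalars to [K] the group still offers only shears
    with parameter in [F], but these nodes already lie there. *)
Lemma coef1_mem (K : fieldType) (f : {rmorphism F -> K}) (W : vectType K)
    (U : {vspace W}) d (w : nat -> W) : (0 < d <= 2 * m)%N ->
  (forall s : F, \sum_(k < d.+1) f s ^+ k *: w k \in U) -> w 1%N \in U.
Proof.
move=> /andP[d0 dm] wU.
apply: (@mem_coef_of_values _ _ U d.+1 (fun j => f j%:R) w _ _
  (Ordinal (d0 : 1 < d.+1)%N)) => //.
move=> i j /fmorph_inj/natr_inj_small e; apply/val_inj/e.
  by rewrite (leq_trans _ dm) // -ltnS.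
by rewrite (leq_trans _ dm) // -ltnS.
Qed.

Lemma le_m_2m : (0 < m <= 2 * m)%N.
Proof. by rewrite m_gt0 leq_pmull. Qed.

Lemma mono_span (v : V) : exists a : nat -> F, v = \sum_(i < m.+1) a i *: mono F m i.
Proof. by exists (fun i => binform_coef i v); apply: mono_decomp. Qed.

Lemma shear_coef_mono0 : shear_coef F m 1 (mono F m 0) = 0.
Proof. by rewrite shear_coef1_mono // scale0r. Qed.

Lemma shear_coef_monoS i : (i < m)%N ->
  shear_coef F m 1 (mono F m i.+1) = i.+1%:R *: mono F m i.
Proof. by move=> im; rewrite shear_coef1_mono. Qed.

Lemma binform_irreducible : irreducible rho.
Proof.
split=> [f0|U subU].
  have := memvf (mono F m 0); rewrite f0 memv0 => /eqP e.
  by have := mono_neq0 F (leq0n m); rewrite e eqxx.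
have gU g v : v \in U -> rho g v \in U.
  by move=> vU; apply/(subvP (subU g))/memv_img.
apply: (ladder_irreducible shear_coef_mono0 shear_coef_monoS natF_ladder
  mono_span (weyl_mono0 F m)) => [|v vU|v /gU //].
  by rewrite signr_eq0.
apply: (@coef1_mem F idfun _ _ m (fun k => shear_coef F m k v) le_m_2m) => s.
have := gU (shear s) _ vU; rewrite (shear_expansion _ (leqnn m)) sum_lfunE.
by under eq_bigr do rewrite scale_lfunE.
Qed.

Lemma binform_absolutely_irreducible : absolutely_irreducible rho.
Proof.
move=> E f; set e := fun i => bc_vec f (mono F m i).
split=> [f0|U subU].
  have := memvf (e 0%N); rewrite f0 memv0 bc_vec_eq0 => /eqP e0.
  by have := mono_neq0 F (leq0n m); rewrite e0 eqxx.
have gU g v : v \in U -> bc_end f (rho g) v \in U.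
  by move=> vU; apply/(subvP (subU g))/memv_img.
apply: (@ladder_irreducible _ _ m e (bc_end f (shear_coef F m 1))
    (bc_end f (rho (weyl F))) ((-1) ^+ m)).
- by rewrite bc_endE shear_coef_mono0; apply/eqP; rewrite bc_vec_eq0.
- by move=> i im; rewrite bc_endE shear_coef_monoS // bc_vecZ rmorph_nat.
- by move=> i /natF_ladder; rewrite -(fmorph_eq0 f) rmorph_nat.
- exact: (bc_vec_span f (c := fun i => binform_coef i) (@mono_decomp F m)).
- by rewrite bc_endE weyl_mono0 bc_vecZ rmorph_sign.
- by rewrite signr_eq0.
- move=> v vU.
  apply: (@coef1_mem _ f _ _ m (fun k => bc_end f (shear_coef F m k) v) le_m_2m) => s.
  have := gU (shear s) _ vU; rewrite (shear_expansion _ (leqnn m)) bc_end_sum.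
  by under eq_bigr do rewrite rmorphXn.
- exact: gU.
Qed.

End Irreducible.

(** * Transvectants *)

Lemma mderivXU (R : comNzRingType) n (i j : 'I_n) :
  ('X_j)^`M(i) = (i == j)%:R :> {mpoly R[n]}.
Proof.
rewrite mderivX mnm1E eq_sym; have [->|] := eqVneq i j; last by rewrite scale0r.
by rewrite scale1r -[X in (X - _)%MM]add0m addmK mpolyX0.
Qed.

Lemma mderivXn_neq (R : comNzRingType) n (i j : 'I_n) k : i != j ->
  ('X_j ^+ k)^`M(i) = 0 :> {mpoly R[n]}.
Proof.
move=> ij; elim: k => [|k IHk]; first by rewrite expr0 -mpolyC1 mderivC.
by rewrite exprS mderivM IHk mderivXU (negPf ij) mul0r mulr0 addr0.
Qed.

Lemma mderivXn_eq (R : comNzRingType) n (i : 'I_n) k :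
  ('X_i ^+ k.+1)^`M(i) = k.+1%:R *: 'X_i ^+ k :> {mpoly R[n]}.
Proof.
elim: k => [|k IHk]; first by rewrite expr1 mderivXU eqxx expr0 scale1r.
rewrite exprS mderivM IHk mderivXU eqxx mul1r -scalerAr -exprS.
by rewrite -{1}['X_i ^+ _]scale1r -scalerDl nat1r.
Qed.

Lemma dhomog_mderiv (R : comNzRingType) n d (p : {mpoly R[n]}) i :
  p \is d.+1.-homog -> p^`M(i) \is d.-homog.
Proof.
move=> hp; apply/dhomogP => k; rewrite mcoeff_msupp mcoeff_mderiv => nz.
have : (k + U_(i))%MM \in msupp p.
  by rewrite mcoeff_msupp; apply: contraNneq nz => ->; rewrite mul0rn.
by move/(dhomogP _ _ _ hp); rewrite /= mdegD mdeg1 addn1 => -[].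
Qed.

Section Transvectant.
Variable F : fieldType.
Implicit Types (p q : {mpoly F[2]}) (A : 'M[F]_2).

(** The chain rule. By the Leibniz rule the property [P] passes to products; it holds for 1 and the
    variables, hence for monomials, and it is linear. *)
Lemma mderiv_lin_subst A i p :
  (p \mPo lin_forms A)^`M(i) = \sum_j A j i *: (p^`M(j) \mPo lin_forms A).
Proof.
pose P p := (p \mPo lin_forms A)^`M(i)
            = \sum_j A j i *: (p^`M(j) \mPo lin_forms A).
rewrite -/(P p).
have PM q r : P q -> P r -> P (q * r).
  rewrite /P rmorphM /= mderivM => -> ->.
  rewrite mulr_suml mulr_sumr -big_split; apply: eq_bigr => j _ /=.
  by rewrite mderivM rmorphD !rmorphM /= scalerDr -scalerAl -scalerAr.
have P1 : P 1.
  rewrite /P rmorph1 -mpolyC1 mderivC big1 // => j _.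
  by rewrite mderivC raddf0 scaler0.
have PX j : P 'X_j.
  rewrite /P comp_mpolyXU -tnth_nth tnth_mktuple raddf_sum (bigD1 i) //=.
  rewrite mderivZ mderivXU eqxx big1 ?addr0 => [|l li]; last first.
    by rewrite mderivZ mderivXU eq_sym (negPf li) scaler0.
  rewrite (bigD1 j) //= mderivXU eqxx comp_mpoly1 big1 ?addr0 // => l lj.
  by rewrite mderivXU (negPf lj) comp_mpoly0 scaler0.
elim/mpolyind: p => [|c k p _ _ Pp].
  by rewrite /P raddf0 mderiv0 big1 // => j _; rewrite mderiv0 raddf0 scaler0.
have PXk : P 'X_[k].
  rewrite mpolyXE_id; apply: big_ind => // j _.
  by elim: (k j) => [|l IHl]; rewrite ?expr0 // exprS; apply: PM.
rewrite /P linearP /= mderivD mderivZ PXk Pp scaler_sumr -big_split.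
apply: eq_bigr => j _ /=.
by rewrite mderivD mderivZ linearP /= scalerDr !scalerA mulrC.
Qed.

(* The k-th transvectant (Cayley's Omega process); the recursive form makes its
   SL_2-equivariance a consequence of the chain rule alone. *)
Fixpoint transvectant (k : nat) p q : {mpoly F[2]} :=
  if k is k'.+1 then
    transvectant k' p^`M(0) q^`M(1) - transvectant k' p^`M(1) q^`M(0)
  else p * q.

Lemma transvectant_linear_l k q : linear (transvectant k ^~ q).
Proof.
elim: k q => [|k IHk] q a u v /=; first by rewrite mulrDl -scalerAl.
by rewrite !mderivD !mderivZ !IHk scalerBr opprD addrACA.
Qed.

Lemma transvectant_linear_r k p : linear (transvectant k p).
Proof.
elim: k p => [|k IHk] p a u v /=; first by rewrite mulrDr -scalerAr.
by rewrite !mderivD !mderivZ !IHk scalerBr opprD addrACA.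
Qed.

Lemma transvectant_sym k p q : transvectant k q p = (-1) ^+ k * transvectant k p q.
Proof.
elim: k p q => [|k IHk] p q /=; first by rewrite mul1r mulrC.
by rewrite IHk (IHk p^`M(0)) -mulrBr exprSr -mulrA mulN1r opprB.
Qed.

(** Each step lowers the degree of both arguments by one. For [a = b = k] all three degrees are 2k,
    so the transvectant of order m/2 is a product on V_m. *)
Lemma transvectant_homog k a b p q :
    p \is (k + a).-homog -> q \is (k + b).-homog ->
  transvectant k p q \is (a + b).-homog.
Proof.
elim: k p q => [|k IHk] p q /= hp hq; first exact: dhomogM.
by apply: rpredB; apply: IHk; apply: dhomog_mderiv.
Qed.

Lemma transvectant0l k q : transvectant k 0 q = 0.
Proof.
have := transvectant_linear_l k q (-1) 0 0.
by rewrite scaler0 addr0 scaleN1r addNr.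
Qed.

Lemma transvectant0r k p : transvectant k p 0 = 0.
Proof. by rewrite transvectant_sym transvectant0l mulr0. Qed.

Lemma transvectant_comb k a b c d p q r s :
  transvectant k (a *: p + b *: q) (c *: r + d *: s)
  = (a * c) *: transvectant k p r + (a * d) *: transvectant k p s
    + (b * c) *: transvectant k q r + (b * d) *: transvectant k q s.
Proof.
rewrite transvectant_linear_l -[b *: q]addr0 transvectant_linear_l transvectant0l addr0.
rewrite !transvectant_linear_r -[d *: s]addr0 !transvectant_linear_r !transvectant0r.
by rewrite !addr0 !scalerDr !scalerA !addrA.
Qed.

Lemma transvectant_subst A k p q :
  transvectant k (p \mPo lin_forms A) (q \mPo lin_forms A)
  = \det A ^+ k *: (transvectant k p q \mPo lin_forms A).
Proof.
elim: k p q => [|k IHk] p q /=; first by rewrite scale1r rmorphM.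
have dE i r : (r \mPo lin_forms A)^`M(i) =
    A 0 i *: (r^`M(0) \mPo lin_forms A) + A 1 i *: (r^`M(1) \mPo lin_forms A).
  rewrite mderiv_lin_subst !big_ord_recl big_ord0 addr0.
  by rewrite (_ : lift _ _ = 1) //; apply/val_inj.
rewrite !dE !transvectant_comb !IHk !scalerA exprSr -scalerA raddfB /=.
move: (_ \mPo _) (_ \mPo _) (_ \mPo _) (_ \mPo _) => x y z t.
(* Of the four products of derivatives, those with equal indices cancel and the two mixed ones
   acquire the factor [\det A]. *)
rewrite det_mx22 -!mul_mpolyC !(rmorphM, rmorphB) /=; ring.
Qed.

(** Only one of the two terms survives at each step, as X^i has no Y-derivative. This explicit value
    shows that the product is nonzero. *)
Lemma transvectant_mono k a b :
  transvectant k ('X_0 ^+ (k + a)) ('X_1 ^+ (k + b))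
  = ((k + a) ^_ k * (k + b) ^_ k)%:R *: ('X_0 ^+ a * 'X_1 ^+ b).
Proof.
elim: k => [|k IHk]; first by rewrite !ffactn0 scale1r.
rewrite /= !addSn !mderivXn_eq !mderivXn_neq // transvectant0l subr0.
rewrite -[X in transvectant k X]addr0 transvectant_linear_l transvectant0l addr0.
rewrite -[X in transvectant k _ X]addr0 transvectant_linear_r transvectant0r addr0.
by rewrite IHk !scalerA -!natrM !ffactSS mulnACA mulnA.
Qed.

End Transvectant.

(** * The ESQ property *)

Section QuotientIso.
Variables (H : groupType) (F : fieldType) (V W : vectType F).
Variables (rho : Defs.modact H V) (sigma : Defs.modact H W) (h : 'Hom(V, W)).
Hypothesis homh : modhom rho sigma h.

Lemma lker_submod : submod rho (lker h).
Proof.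
move=> g; apply/subvP => _ /memv_imgP[v vK ->].
by rewrite memv_ker homh; move: vK; rewrite memv_ker => /eqP ->; rewrite linear0.
Qed.

Lemma limg_submod : submod sigma (limg h).
Proof.
move=> g; apply/subvP => _ /memv_imgP[_ /memv_imgP[v _ ->] ->].
by rewrite -homh memv_img ?memvf.
Qed.

(** The first isomorphism theorem for modules. *)
Lemma quot_lker_isom : limg h = fullv ->
  exists (U : {vspace V}) (subU : submod rho U), mod_isom (quot_mod subU) sigma.
Proof.
move=> hfull; exists (lker h), lker_submod.
have hE v : quotv_lift (lker h) h (quotv_pi (lker h) v) = h v.
  exact: quotv_liftE (subvv _).
exists (quotv_lift (lker h) h) => [g u|].
  rewrite -(quotv_piK u) [quot_mod _ _ _](quot_funE lker_submod) !hE.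
  exact: homh.
have inj : lker (quotv_lift (lker h) h) == 0%VS.
  apply/eqP/vspaceP => u; rewrite memv_ker memv0 -(quotv_piK u) hE.
  apply/eqP/eqP => [hu|/quotv_pi_eq]; last by rewrite memv_ker => /eqP.
  by apply/quotv_pi_eq; rewrite memv_ker hu.
exists ((quotv_lift (lker h) h)^-1%VF); first exact: lker0_lfunK inj.
move=> w; have : w \in limg h by rewrite hfull memvf.
by case/memv_imgP => v _ ->; rewrite -hE lker0_lfunK.
Qed.

End QuotientIso.

Lemma ext2_ext (F : fieldType) (V W : vectType F) (h k : 'Hom(ext2 V, W)) :
  (forall u v, h (wedge u v) = k (wedge u v)) -> h = k.
Proof.
move=> hk; apply: quotv_ext => T; rewrite -[LHS]comp_lfunE -[RHS]comp_lfunE.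
congr (fun_of_lfun _ T); apply: tens_ext => u v.
by rewrite [LHS]comp_lfunE [RHS]comp_lfunE; apply: hk.
Qed.

Lemma binform_ESQ (F : fieldType) (h : nat) : odd h ->
    (forall i, (0 < i <= 2 * (h + h))%N -> i%:R != 0 :> F) ->
  ESQ_module (binform_mod F (h + h)).
Proof.
move=> oh natF; set V := dhomog 2 F (h + h).
have h0 : (0 < h)%N by case: h oh {natF V}.
pose b (p q : V) : V := DHomog (transvectant_homog (valP p) (valP q)).
have br p : linear (b p).
  move=> a q r; apply/val_inj; exact: transvectant_linear_r.
have bl q : linear (b ^~ q).
  move=> a p r; apply/val_inj; exact: transvectant_linear_l.
have two0 : 2%:R != 0 :> F by apply: natF; rewrite leq_pmulr // addn_gt0 h0.
(* Odd order makes the transvectant antisymmetric; as 2 is invertible, it is alternating. *)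
have bb p : b p p = 0.
  apply/val_inj => /=; apply/eqP.
  have := transvectant_sym h (val p) (val p).
  rewrite -signr_odd oh mulN1r => /eqP; rewrite -addr_eq0 -mulr2n -scaler_nat.
  by rewrite scaler_eq0 (negPf two0).
have [psi [psiE _]] := ext2_universal br bl bb.
have psihom : modhom (ext2_mod (binform_mod F (h + h))) (binform_mod F (h + h)) psi.
  move=> g u.
  rewrite -[LHS]comp_lfunE -[RHS]comp_lfunE; congr (fun_of_lfun _ u).
  apply: ext2_ext => p q; rewrite [LHS]comp_lfunE [RHS]comp_lfunE.
  rewrite ext2_modE psiE [psi _]psiE.
  apply/val_inj; rewrite /= !lfunE /= transvectant_subst (eqP (SL_det g)).
  by rewrite expr1n scale1r.
apply: (quot_lker_isom psihom).
have [//|im0|//] := (binform_irreducible _ natF).2 _ (limg_submod psihom).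
  by rewrite addn_gt0 h0.
(* The image is nonzero: X^(2h) and Y^(2h) have as product a multiple of X^h Y^h whose factor is a
   square of a falling factorial, invertible in [F]. *)
have : psi (wedge (mono F (h + h) (h + h)) (mono F (h + h) 0)) \in limg psi.
  by rewrite memv_img ?memvf.
rewrite im0 memv0 psiE => /eqP/(congr1 val) /=.
rewrite !mpolyX_mono_exp minnn subnn min0n subn0 !expr0 mulr1 mul1r.
rewrite transvectant_mono -mpolyX_mono_exp => /(congr1 (mcoeff (mono_exp h h))).
have ffk k : (k <= h + h)%N -> ((h + h) ^_ k)%:R != 0 :> F.
  elim: k => [|k IHk] lek; first by rewrite ffactn0 oner_neq0.
  rewrite ffactnSr natrM mulf_neq0 ?IHk ?(ltnW lek) // natF // subn_gt0 lek.
  by rewrite (leq_trans (leq_subr _ _)) // leq_pmull.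
rewrite mcoeffZ mcoeffX eqxx mulr1 mcoeff0 natrM => /eqP.
by rewrite mulf_eq0 orbb (negPf (ffk h (leq_addr h h))).
Qed.

(** * Invariant products on irreducible modules *)

Lemma dim_limg_le (F : fieldType) (V W : vectType F) (f : 'Hom(V, W))
    (U : {vspace V}) :
  (\dim (f @: U) <= \dim U)%N.
Proof. by rewrite -(limg_ker_dim f U) leq_addl. Qed.

Section InvariantProduct.
Variables (H : groupType) (F : fieldType) (V : vectType F) (rho : Defs.modact H V).

Lemma modactK g v : rho g^-1%g (rho g v) = v.
Proof. by rewrite -comp_lfunE -Defs.actM mulgV Defs.act1 lfunE. Qed.

Lemma modactVK g v : rho g (rho g^-1%g v) = v.
Proof. by rewrite -comp_lfunE -Defs.actM mulVg Defs.act1 lfunE. Qed.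

Hypothesis irr : irreducible rho.

(** Strong induction on the dimension of [C]: if some g does not preserve [C], then the intersection
    of [C] with its translate by g is strictly smaller and still contains the orbit of [v]. *)
Lemma irreducible_orbit_full (v : V) (C : {vspace V}) : v != 0 ->
  (forall g, rho g v \in C) -> C = fullv.
Proof.
move=> v0; elim: {C}_.+1 {-2}C (ltnSn (\dim C)) => // n IHn C Cn Cv.
have [subC|nsub] := classic (submod rho C).
  case: (irr.2 C subC) => // C0.
  have := Cv 1%g; rewrite Defs.act1 lfunE /= C0 memv0 => /eqP e.
  by rewrite e eqxx in v0.
have [g gC] := not_all_ex_not _ _ nsub.
have lt : (\dim (C :&: rho g @: C) < \dim C)%N.
  rewrite ltn_neqAle dimvS ?capvSl // andbT; apply/negP => e; apply: gC.
  have CgC : (C <= rho g @: C)%VS.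
    have /eqP CE : (C :&: rho g @: C == C)%VS by rewrite eqEdim capvSl (eqP e) leqnn.
    by rewrite -{1}CE capvSr.
  have /eqP <- : (C == rho g @: C)%VS by rewrite eqEdim CgC dim_limg_le.
  exact: subvv.
have full : (C :&: rho g @: C = fullv)%VS.
  apply: IHn => [|h]; first exact: leq_trans lt _.
  rewrite memv_cap Cv; apply/memv_imgP; exists (rho (h * g^-1)%g v) => //.
  by rewrite Defs.actM comp_lfunE modactVK.
by apply/eqP; rewrite eqEsubv subvf /= -full capvSl.
Qed.

Variable mul : V -> V -> V.
Hypothesis mul_linear_l : forall y, linear (mul^~ y).
Hypothesis mul_linear_r : forall x, linear (mul x).

Definition mulL (x : V) : 'End(V) :=
  linfun (HB.pack_for {linear V -> V} (mul x)
    (GRing.isLinear.Build F V V _ (mul x) (mul_linear_r x))).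
Definition mulR (y : V) : 'End(V) :=
  linfun (HB.pack_for {linear V -> V} (mul^~ y)
    (GRing.isLinear.Build F V V _ (mul^~ y) (mul_linear_l y))).

Lemma mulLE x y : mulL x y = mul x y. Proof. by rewrite lfunE. Qed.
Lemma mulRE x y : mulR y x = mul x y. Proof. by rewrite lfunE. Qed.

Definition prod_space (A B : {vspace V}) : {vspace V} :=
  span [seq mul x y | x <- vbasis A, y <- vbasis B].

Lemma prod_space_sub (A B C : {vspace V}) :
  (prod_space A B <= C)%VS <-> forall x y, x \in A -> y \in B -> mul x y \in C.
Proof.
split=> [sC x y xA yB | mC]; last first.
  apply/span_subvP => _ /allpairsP[[x y] [xA yB ->]].
  by apply: mC; apply: vbasis_mem.
have bC (b c : V) : b \in vbasis A -> c \in vbasis B -> mul b c \in C.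
  by move=> bA cB; apply/(subvP sC)/memv_span/allpairsP; exists (b, c).
rewrite -mulRE (coord_vbasis xA) linear_sum; apply: rpred_sum => i _.
rewrite linearZ /=; apply: rpredZ.
rewrite mulRE -mulLE (coord_vbasis yB) linear_sum; apply: rpred_sum => j _.
by rewrite linearZ /=; apply: rpredZ; rewrite mulLE bC // mem_nth ?size_tuple.
Qed.

Lemma mem_prod_space (A B : {vspace V}) x y :
  x \in A -> y \in B -> mul x y \in prod_space A B.
Proof. by move: x y; apply/prod_space_sub. Qed.

Hypothesis mul_alt : forall x, mul x x = 0.
Hypothesis mul_act : forall g x y, rho g (mul x y) = mul (rho g x) (rho g y).

Lemma mul_anti x y : mul y x = - mul x y.
Proof.
have Dl a b c : mul (a + b) c = mul a c + mul b c by rewrite -!mulRE linearD.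
have Dr a b c : mul c (a + b) = mul c a + mul c b by rewrite -!mulLE linearD.
have := mul_alt (x + y); rewrite Dl !Dr !mul_alt addr0 add0r addrC.
by move/eqP; rewrite addr_eq0 => /eqP.
Qed.

Lemma act_ideal g I : alg_ideal mul I -> alg_ideal mul (rho g @: I)%VS.
Proof.
move=> idI _ y /memv_imgP[u uI ->]; rewrite -(modactVK g y) -!mul_act.
by split; apply: memv_img; have [] := idI u (rho g^-1%g y) uI.
Qed.

(* A minimal ideal [I] meets each translate [rho g I] in [0] or [I], so
   [mul (rho g I) I] lies in [I^2]; the orbit of [I] spanning [V], [I^2] is
   itself an ideal. *)
Lemma minimal_ideal_perfect (I : {vspace V}) :
    (exists x y, mul x y != 0) -> alg_ideal mul I -> I != 0%VS ->
    (forall J, alg_ideal mul J -> J != 0%VS -> (J <= I)%VS -> J = I) ->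
  prod_space I I = I.
Proof.
move=> [x0 [y0 xy0]] idI I0 minI; set P := prod_space I I.
have v0 : vpick I != 0 by rewrite vpick0.
have mulP x y : y \in I -> mul x y \in P.
  move=> yI; suff : x \in (mulR y @^-1: P)%VS by rewrite -memv_preim mulRE.
  (* The [x] with [mul x y] in [P] form a subspace, so the orbit of a single nonzero vector of [I]
     suffices. *)
  suff -> : (mulR y @^-1: P)%VS = fullv by exact: memvf.
  apply: (irreducible_orbit_full v0) => g; rewrite -memv_preim mulRE.
  have gv : rho g (vpick I) \in (rho g @: I)%VS by rewrite memv_img ?memv_pick.
  have idg := @act_ideal g _ idI; set J := (rho g @: I)%VS in gv idg.
  have [JI0|JI0] := eqVneq (J :&: I)%VS 0%VS.
    have : mul (rho g (vpick I)) y \in (J :&: I)%VS.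
      by rewrite memv_cap (idg _ y gv).1 (idI _ (rho g (vpick I)) yI).2.
    by rewrite JI0 memv0 => /eqP ->; apply: mem0v.
  have JI : (J :&: I = I)%VS.
    apply: minI => //; last exact: capvSr.
    move=> a b; rewrite !memv_cap => /andP[aJ aI].
    by have [-> ->] := idg a b aJ; have [-> ->] := idI a b aI.
  have IJ : (I <= J)%VS by rewrite -JI capvSl.
  apply: mem_prod_space => //.
  have /eqP IE : (I == J)%VS by rewrite eqEdim IJ dim_limg_le.
  by move: gv; rewrite -IE.
have PI : (P <= I)%VS by apply/prod_space_sub => a b aI _; have [] := idI a b aI.
apply: (minI _ _ _ PI) => [a b /(subvP PI) aI|].
  by rewrite [mul a b]mul_anti rpredN mulP.
(* If [P] were zero, every product with a factor in [I] would vanish, hence by equivariance every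
   product with a factor in a translate of [I]; the translates span [V]. *)
apply: contraNneq xy0 => P0.
suff /vspaceP/(_ y0) : lker (mulL x0) = fullv by rewrite memvf memv_ker mulLE.
apply: (irreducible_orbit_full v0) => g; rewrite memv_ker mulLE.
rewrite -(modactVK g x0) -mul_act.
have : mul (rho g^-1%g x0) (vpick I) \in P by rewrite mulP ?memv_pick.
by rewrite P0 memv0 => /eqP ->; rewrite linear0.
Qed.

(** In D(ab) = (Da)b + a(Db) each term keeps a factor from [I], wherever Da and Db lie; a perfect
    ideal is spanned by such ab. *)
Lemma perfect_ideal_derivation (I : {vspace V}) (D : 'End(V)) :
    alg_ideal mul I -> prod_space I I = I ->
    (forall x y, D (mul x y) = mul (D x) y + mul x (D y)) ->
  forall x, x \in I -> D x \in I.
Proof.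
move=> idI pI der x; rewrite -{1}pI => xP.
suff /subvP/(_ x xP) : (prod_space I I <= D @^-1: I)%VS by rewrite -memv_preim.
apply/prod_space_sub => a b aI bI; rewrite -memv_preim der.
by apply: rpredD; [have [] := idI b (D a) bI | have [] := idI a (D b) aI].
Qed.

End InvariantProduct.

(** * Simplicity *)

(** Regroups a product of two polynomials in s by total degree, which is why nodes up to 2m are
    required. *)
Lemma double_sum_by_degree (R : pzRingType) (V : lmodType R) (m : nat) (s : R)
    (a : 'I_m.+1 -> 'I_m.+1 -> V) :
  \sum_(i < m.+1) \sum_(j < m.+1) s ^+ (i + j) *: a i j
  = \sum_(k < (2 * m).+1)
      s ^+ k *: \sum_(i < m.+1) \sum_(j < m.+1 | (i + j == k)%N) a i j.
Proof.
under [RHS]eq_bigr do rewrite scaler_sumr.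
rewrite [RHS]exchange_big; apply: eq_bigr => i _ /=.
under [RHS]eq_bigr do rewrite scaler_sumr big_mkcond.
rewrite [RHS]exchange_big; apply: eq_bigr => j _ /=.
have ij : (i + j < (2 * m).+1)%N.
  by rewrite ltnS mul2n -addnn leq_add // -ltnS.
rewrite (bigD1 (Ordinal ij)) //= eqxx big1 ?addr0 // => k.
by rewrite -val_eqE /= eq_sym => /negPf ->.
Qed.

Lemma sum_degree1 (V : nmodType) (m : nat) (a : nat -> nat -> V) : (0 < m)%N ->
  \sum_(i < m.+1) \sum_(j < m.+1 | (i + j == 1)%N) a i j = a 0%N 1%N + a 1%N 0%N.
Proof.
case: m => // m _; rewrite !big_ord_recl /=; congr (_ + _).
  by rewrite (big_pred1 (lift ord0 ord0)).
rewrite [X in _ + X]big1 ?addr0 => [|i _]; last by rewrite big_pred0.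
by rewrite (big_pred1 ord0).
Qed.

Section InvariantProductOnForms.
Variables (F : fieldType) (m : nat).
Hypothesis m_gt0 : (0 < m)%N.
Hypothesis natF : forall i, (0 < i <= 2 * m)%N -> i%:R != 0 :> F.
Local Notation V := (dhomog 2 F m).
Local Notation rho := (binform_mod F m).
Variable mul : V -> V -> V.
Hypothesis mul_linear_l : forall y, linear (mul^~ y).
Hypothesis mul_linear_r : forall x, linear (mul x).
Hypothesis mul_act : forall g x y, rho g (mul x y) = mul (rho g x) (rho g y).
Local Notation D := (shear_coef F m 1).

(* Compare the coefficients of [s] in [rho (shear s) (mul x y) =
   mul (rho (shear s) x) (rho (shear s) y)], polynomial of degree [<= 2m] in [s]. *)
Lemma shear_coef1_derivation x y : D (mul x y) = mul (D x) y + mul x (D y).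
Proof.
pose N k := shear_coef F m k.
pose w k := N k (mul x y) -
  \sum_(i < m.+1) \sum_(j < m.+1 | (i + j == k)%N) mul (N i x) (N j y).
have d2 : (0 < 2 * m <= 2 * m)%N by rewrite muln_gt0 m_gt0 leqnn.
(* With the zero subspace, [coef1_mem] says that a polynomial in s with only zero values has zero
   coefficient at s. *)
suff : w 1%N \in 0%VS.
  rewrite memv0 subr_eq0 (sum_degree1 (fun i j => mul (N i x) (N j y))) //.
  by rewrite /N !shear_coef0 addrC => /eqP.
apply: (coef1_mem natF (f := idfun) d2) => s; rewrite memv0.
under eq_bigr do rewrite scalerBr.
rewrite sumrB -double_sum_by_degree subr_eq0; apply/eqP.
have mm : (m <= 2 * m)%N by rewrite leq_pmull.
transitivity (rho (shear s) (mul x y)).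
  rewrite (shear_expansion _ mm) sum_lfunE.
  by apply: eq_bigr => k _; rewrite scale_lfunE.
rewrite mul_act (shear_expansion _ (leqnn m)) !sum_lfunE.
rewrite -(mulRE mul_linear_l) linear_sum; apply: eq_bigr => i _ /=.
rewrite mulRE -(mulLE mul_linear_r) linear_sum; apply: eq_bigr => j _ /=.
rewrite mulLE !scale_lfunE -(mulLE mul_linear_r) linearZ /= mulLE.
by rewrite -(mulRE mul_linear_l) linearZ /= mulRE scalerA mulrC -exprD.
Qed.

Hypothesis mul_alt : forall x, mul x x = 0.
Hypothesis mul_neq0 : exists x y, mul x y != 0.

Lemma binform_simple_alg : simple_alg mul.
Proof.
have irr := binform_irreducible m_gt0 natF.
split=> [|I idI]; first exact: irr.1.
have [->|I0] := eqVneq I 0%VS; [by left|right].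
(* In the induction on the dimension, a nonzero ideal properly inside [I] would already be [V],
   which is absurd; so [I] may be taken minimal. *)
have [n] := ubnP (\dim I); elim: n I idI I0 => // n IHn I idI I0 In.
have perfI : prod_space mul I I = I.
  apply: (minimal_ideal_perfect irr mul_linear_l mul_linear_r mul_alt mul_act
    mul_neq0 idI I0) => J idJ J0 JI.
  apply/eqP; rewrite eqEdim JI /= leqNgt; apply/negP => ltJ.
  have J1 : J = fullv by apply: IHn => //; apply: leq_trans ltJ _; rewrite -ltnS.
  by move: ltJ; rewrite J1 ltnNge dimvS ?subvf.
have e0 g : mono F m 0 \in (rho g @: I)%VS.
  apply: (ladder_bottom_mem (shear_coef_mono0 F m) (@shear_coef_monoS F m)
    (natF_ladder natF) (@mono_span F m)) => [_ /memv_imgP[u uI ->]|]; last first.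
    apply: contraNneq I0 => gI0; rewrite -vpick0.
    have : rho g (vpick I) \in (rho g @: I)%VS by rewrite memv_img ?memv_pick.
    by rewrite gI0 memv0 => /eqP e; rewrite -(modactK rho g (vpick I)) e linear0.
  (* The translate is stable under [D] when [I] is stable under the conjugate [D'], which is a
     derivation because [rho g] preserves the product. *)
  pose D' : 'End(V) := (rho g^-1%g \o (D \o rho g))%VF.
  have D'E v : D' v = rho g^-1%g (D (rho g v)) by rewrite !comp_lfunE.
  have -> : D (rho g u) = rho g (D' u) by rewrite D'E modactVK.
  apply: memv_img.
  apply: (perfect_ideal_derivation mul_linear_l mul_linear_r idI perfI) uI => x y.
  have rhoD h a b : rho h (a + b) = rho h a + rho h b by exact: linearD.
  by rewrite !D'E mul_act shear_coef1_derivation rhoD !mul_act !modactK.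
apply: (ladder_full (@shear_coef_monoS F m) (natF_ladder natF) _ (@mono_span F m)).
  move=> v; apply: (perfect_ideal_derivation mul_linear_l mul_linear_r idI perfI) => x y.
  exact: shear_coef1_derivation.
(* As Y^m lies in the translate by the inverse Weyl element, [I] contains the Weyl image of Y^m,
   which is X^m up to sign. *)
have /memv_imgP[u uI e] := e0 (weyl F)^-1%g.
have := congr1 (rho (weyl F)) e; rewrite modactVK weyl_mono0 => ue.
rewrite -ue in uI; have := memvZ ((-1) ^+ m) uI.
by rewrite scalerA -expr2 sqrr_sign scale1r.
Qed.

End InvariantProductOnForms.

Theorem theorem8p1 (m : nat) (F : fieldType)
    (m_gt0 : (0 < m)%N) (m_mod4 : (m = 2 %[mod 4])%N)
    (charF : [pchar F] =i pred0 \/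
             exists2 p : nat, p \in [pchar F] & (2 * m < p)%N) :
  absolutely_irreducible (binform_mod F m) /\
  ESQ_module (binform_mod F m) /\
  ((exists s : seq F, uniq s /\ size s = 5%N) ->
   forall psi : 'Hom(ext2 (dhomog 2 F m), dhomog 2 F m),
     modhom (ext2_mod (binform_mod F m)) (binform_mod F m) psi ->
     limg psi = fullv ->
     IAC_alg (esq_prod psi) /\ simple_alg (esq_prod psi)).
Proof.
have natF i : (0 < i <= 2 * m)%N -> i%:R != 0 :> F.
  move=> /andP[i0 im]; case: charF => [char0|[p charp mp]].
    by have /pcharf0P -> := char0; rewrite -lt0n.
  rewrite -(dvdn_pcharf charp) gtnNdvd //; exact: leq_ltn_trans mp.
have irr := binform_irreducible m_gt0 natF.
(* The congruence modulo 4 says that m/2, the order of the transvectant, is odd. *)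
have [h oh mE] : exists2 h, odd h & m = (h + h)%N.
  exists m./2; lia.
split; first exact: binform_absolutely_irreducible m_gt0 natF.
split; first by move: natF; rewrite mE; apply: binform_ESQ.
move=> _ psi psihom psifull.
have alt x : esq_prod psi x x = 0 by rewrite /esq_prod wedge_alt linear0.
have lin_l y : linear (esq_prod psi ^~ y).
  by move=> a u v; rewrite /esq_prod wedge_linear_l linearP.
have lin_r x : linear (esq_prod psi x).
  by move=> a u v; rewrite /esq_prod wedge_linear_r linearP.
have equi g x y : binform_mod F m g (esq_prod psi x y) =
    esq_prod psi (binform_mod F m g x) (binform_mod F m g y).
  by rewrite /esq_prod -psihom ext2_modE.
split; last first.
  apply: (binform_simple_alg m_gt0 natF lin_l lin_r equi alt).
  apply: NNPP => mul0; apply: irr.1; rewrite -psifull.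
  suff -> : psi = 0%VF.
    apply/eqP; rewrite -subv0; apply/subvP => _ /memv_imgP[v _ ->].
    by rewrite lfunE /= mem0v.
  apply: ext2_ext => u v; rewrite lfunE /=; apply/eqP/negPn/negP => uv.
  by apply: mul0; exists u, v.
split=> //; split; first exact: irr.1.
(* Each [rho g] is an algebra automorphism, so irreducibility passes from the group to the
   automorphisms. *)
move=> U autU; apply: irr.2 => g; apply: autU; split; last exact: equi.
by exists (binform_mod F m g^-1%g) => v; [exact: modactK | exact: modactVK].
Qed.
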